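(* Let $(e_n)_{n=1}^\infty$ be a sequence of non-zero vectors in a Banach lattice $X$ such that $X=[e_n]$. The following conditions are equivalent: (1) $(e_n)$ is a uniform basis for $X$; (2) $(e_n)$ is a Schauder basis for $X$ (with biorthogonal functionals $e_n^*$) such that, for every $x\in X$, the sequence of partial sums $P_mx=\sum_{n=1}^m e_n^*(x)e_n$ ($m\ge 1$) is order bounded in $X$; (3) there is a constant $M$ such that, for all finite tuples of scalars $(a_n)_{n=1}^m$, $$\Big\|\bigvee_{k=1}^m\Big|\sum_{n=1}^k a_ne_n\Big|\,\Big\|\le M\Big\|\sum_{n=1}^m a_ne_n\Big\|.$$
   Context: All Banach lattices are real. $[e_n]$ denotes the norm-closed linear span of $(e_n)$. A sequence $(x_n)$ in a Banach lattice $X$ converges uniformly to $x$ if there is $z\in X_+$ such that for every $m$, $|x_n-x|\le \frac zm$ for all but finitely many $n$. A sequence $(e_n)$ in $X$ is a uniform basis for $X$ if for every $x\in X$ there is a unique $(a_n)\in\mathbb R^{\mathbb N}$ such that the partial sums $\sum_{n=1}^m a_ne_n$ converge uniformly to $x$ as $m\to\infty$. A Schauder basis is defined in the same way with norm convergence in place of uniform convergence, and its biorthogonal functionals are $e_k^*(x)=a_k$, where $(a_n)$ is the unique coefficient sequence of $x$. *)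

(* Defs.v *)
From HB Require Import structures.
From mathcomp Require Import all_boot all_order all_algebra.
From mathcomp Require Import boolp classical_sets functions reals topology.
From mathcomp Require Import normedtype sequences.

Set Implicit Arguments.
Unset Strict Implicit.
Unset Printing Implicit Defensive.

Import Order.TTheory GRing.Theory Num.Theory.
Import numFieldNormedType.Exports.

Local Open Scope classical_set_scope.
Local Open Scope ring_scope.

(* A real Banach lattice: a Banach space with a lattice order which is
   compatible with the vector space operations, and whose norm is monotone with
   respect to the absolute value |x| = x \/ (- x). A plain record is used
   because Hierarchy Builder requires joins between the order and the normed
   structures that the library does not declare. *)
Record banachLatticeType (R : realType) := BanachLattice {
  bl_space : completeNormedModType R ;
  bl_le : rel bl_space ;
  bl_meet : bl_space -> bl_space -> bl_space ;
  bl_join : bl_space -> bl_space -> bl_space ;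
  bl_le_refl : reflexive bl_le ;
  bl_le_anti : antisymmetric bl_le ;
  bl_le_trans : transitive bl_le ;
  bl_meetP : forall x y z,
    bl_le x (bl_meet y z) = bl_le x y && bl_le x z ;
  bl_joinP : forall x y z,
    bl_le (bl_join x y) z = bl_le x z && bl_le y z ;
  bl_leD2r : forall z x y, bl_le x y -> bl_le (x + z) (y + z) ;
  bl_leZ2l : forall (c : R) x y, 0 <= c -> bl_le x y -> bl_le (c *: x) (c *: y) ;
  bl_norm_le : forall x y,
    bl_le (bl_join x (- x)) (bl_join y (- y)) -> `|x| <= `|y|
}.

Definition bl_sort (R : realType) (X : banachLatticeType R) : Type :=
  bl_space X.
Coercion bl_sort : banachLatticeType >-> Sortclass.

HB.instance Definition _ (R : realType) (X : banachLatticeType R) :=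
  CompleteNormedModule.copy (bl_sort X) (bl_space X).

(* The display [ring_display] makes [x <= y] in [ring_scope] the order of X. *)
HB.instance Definition _ (R : realType) (X : banachLatticeType R) :=
  Order.Le_isPOrder.Build ring_display (bl_sort X)
    (@bl_le_refl R X) (@bl_le_anti R X) (@bl_le_trans R X).

HB.instance Definition _ (R : realType) (X : banachLatticeType R) :=
  Order.POrder_MeetJoin_isLattice.Build ring_display (bl_sort X)
    (@bl_meetP R X) (@bl_joinP R X).

Section Bases.
Variables (R : realType) (X : banachLatticeType R).
Implicit Types (x z : X) (u e : X^nat) (a : R^nat).

(* The lattice absolute value; the notation `|x| denotes the norm. *)
Definition labs x : X := Order.join x (- x).

Definition uniform_cvg u x : Prop :=
  exists2 z : X, 0 <= z &
    forall m : nat, (0 < m)%N -> \forall n \near \oo, labs (u n - x) <= m%:R^-1 *: z.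

Definition order_bounded (A : set X) : Prop := has_lbound A /\ has_ubound A.

(* [psums e a m] is the sum of the a_n e_n over n < m. *)
Definition psums e a : X^nat := series (fun n => a n *: e n).

Definition lin_span e : set X := [set x | exists a m, x = psums e a m].

Definition uniform_basis e : Prop :=
  forall x, exists! a : R^nat, uniform_cvg (psums e a) x.

Definition schauder_basis e : Prop :=
  forall x, exists! a : R^nat, psums e a @ \oo --> x.

(* The value e_n^*(x) of the n-th biorthogonal functional of a Schauder basis;
   the default value is irrelevant when e is a Schauder basis. *)
Definition biorth e (n : nat) x : R :=
  xget (fun=> 0) [set a : R^nat | psums e a @ \oo --> x] n.

(* As e is indexed from 0, the projections P_m with m >= 1 of the literature
   are the [basis_proj e m] with m >= 1. *)
Definition basis_proj e (m : nat) x : X := \sum_(n < m) biorth e n x *: e n.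

End Bases.

(* Main.v *)
Require Import Defs.
From HB Require Import structures.
From mathcomp Require Import all_boot all_order all_algebra.
From mathcomp Require Import boolp classical_sets functions reals topology.
From mathcomp Require Import normedtype sequences.

Import Order.TTheory GRing.Theory Num.Theory.
Import numFieldNormedType.Exports.

Local Open Scope classical_set_scope.
Local Open Scope ring_scope.

(* The three conditions are tied together by an argument in the style of the
   open mapping theorem.  Call x expandable with bound c if it has an expansion
   whose partial sums converge to x and are dominated in absolute value by some
   z with |z| <= c.  If vectors expandable with bound c are dense in a ball of
   radius r, then x in that ball is a series of vectors x_j expandable with
   bounds z_j, |z_j| <= c 4^-j; adding the expansions expands x, since
   w = sum_j 2^j z_j satisfies sum_(j >= N) z_j <= 2^-N w, so that the tails are
   small even relative to one fixed regulator.  Given (3), finite expansions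
   provide such a dense set, which yields the bases in (1) and (2).  Given (1)
   or (2), Baire's theorem provides it, and uniqueness of the coefficients turns
   the resulting bound into (3). *)

(** * Order, absolute value and closedness of order bounds in a Banach lattice *)

Section BanachLatticeTheory.
Context {R : realType} {X : banachLatticeType R}.
Implicit Types (x y z : X) (u v : X^nat) (c : R).

Lemma bl_lerD2r z x y : (x + z <= y + z) = (x <= y).
Proof.
apply/idP/idP => [h|]; last exact: bl_leD2r.
by have := bl_leD2r (- z) h; rewrite !addrK.
Qed.

Lemma bl_lerD2l z x y : (z + x <= z + y) = (x <= y).
Proof. by rewrite ![z + _]addrC bl_lerD2r. Qed.

Lemma bl_lerD x y z t : x <= y -> z <= t -> x + z <= y + t.
Proof.
by move=> xy zt; apply: (@le_trans _ _ (y + z)); rewrite ?bl_lerD2r ?bl_lerD2l.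
Qed.

Lemma bl_subr_ge0 x y : (0 <= y - x) = (x <= y).
Proof. by rewrite -(bl_lerD2r x 0) add0r subrK. Qed.

Lemma bl_lerN x y : (- x <= - y) = (y <= x).
Proof. by rewrite -(bl_subr_ge0 (- x)) opprK addrC bl_subr_ge0. Qed.

Lemma bl_scaler_ge0 c x : 0 <= c -> 0 <= x -> 0 <= c *: x.
Proof. by move=> c0 x0; have := bl_leZ2l c0 x0; rewrite scaler0. Qed.

Lemma bl_ler_wpZ2l c x y : 0 <= c -> x <= y -> c *: x <= c *: y.
Proof. exact: bl_leZ2l. Qed.

Lemma bl_ler_wpZ2r x c d : 0 <= x -> c <= d -> c *: x <= d *: x.
Proof.
move=> x0 cd; rewrite -bl_subr_ge0 -scalerBl; apply: bl_scaler_ge0 => //.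
by rewrite subr_ge0.
Qed.

Lemma labs_le x y : (labs x <= y) = (x <= y) && (- x <= y).
Proof. by rewrite /labs leUx. Qed.

Lemma ler_labs x : x <= labs x.
Proof. exact: leUl. Qed.

Lemma lerN_labs x : - x <= labs x.
Proof. exact: leUr. Qed.

Lemma labsN x : labs (- x) = labs x.
Proof. by rewrite /labs opprK joinC. Qed.

(** Adding the bounds of [x] and [- x] by [labs x] gives [0 <= labs x + labs x], which is then
    halved. *)
Lemma labs_ge0 x : 0 <= labs x.
Proof.
have h2 : 0 <= labs x + labs x.
  by rewrite -(subrr x); apply: bl_lerD (ler_labs x) (lerN_labs x).
suff -> : labs x = 2^-1 *: (labs x + labs x).
  by apply: bl_scaler_ge0 h2; rewrite invr_ge0.
by rewrite -mulr2n -(scaler_nat 2 (labs x)) scalerA mulVf ?pnatr_eq0// scale1r.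
Qed.

Lemma labs_idP x : reflect (labs x = x) (0 <= x).
Proof.
apply: (iffP idP) => [x0|<-]; last exact: labs_ge0.
apply/le_anti; rewrite ler_labs labs_le lexx /=.
by rewrite (le_trans _ x0)// -oppr0 bl_lerN.
Qed.

Lemma labs_ger0 {x} : 0 <= x -> labs x = x.
Proof. by move/labs_idP. Qed.

Lemma labs_le_ge0 {x y} : labs x <= y -> 0 <= y.
Proof. exact: le_trans (labs_ge0 x). Qed.

Lemma labs0 : labs (0 : X) = 0.
Proof. exact: labs_ger0. Qed.

Lemma ler_labsD x y : labs (x + y) <= labs x + labs y.
Proof.
by rewrite labs_le opprD !bl_lerD ?ler_labs ?lerN_labs.
Qed.

Lemma labsZ c x : labs (c *: x) <= `|c| *: labs x.
Proof.
rewrite labs_le; have [c0|c0] := ger0P c.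
  by rewrite -scalerN !bl_ler_wpZ2l ?ler_labs ?lerN_labs.
rewrite -scaleNr -[c *: x]opprK -scaleNr -scalerN.
by rewrite !bl_ler_wpZ2l ?oppr_ge0 ?(ltW c0) ?ler_labs ?lerN_labs.
Qed.

Lemma bl_sumr_ge0 (I : Type) (r : seq I) (P : pred I) (F : I -> X) :
  (forall i, P i -> 0 <= F i) -> 0 <= \sum_(i <- r | P i) F i.
Proof.
by move=> F0; elim/big_ind: _ => // x y x0 y0; rewrite -(addr0 0) bl_lerD.
Qed.

Lemma bl_ler_sum (I : Type) (r : seq I) (P : pred I) (F G : I -> X) :
  (forall i, P i -> F i <= G i) ->
  \sum_(i <- r | P i) F i <= \sum_(i <- r | P i) G i.
Proof. by move=> FG; elim/big_ind2: _ => // *; exact: bl_lerD. Qed.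

Lemma ler_labs_sum (I : Type) (r : seq I) (P : pred I) (F : I -> X) :
  labs (\sum_(i <- r | P i) F i) <= \sum_(i <- r | P i) labs (F i).
Proof.
elim/big_ind2: _ => [|x y z t xy zt|//]; first by rewrite labs0.
by apply: le_trans (ler_labsD _ _) _; exact: bl_lerD.
Qed.

Lemma ler_norm_labs2 x y : labs x <= labs y -> `|x| <= `|y|.
Proof. exact: bl_norm_le. Qed.

Lemma norm_labs x : `|labs x| = `|x|.
Proof.
have h : labs (labs x) = labs x by apply/labs_idP; exact: labs_ge0.
by apply/le_anti/andP; split; apply: ler_norm_labs2; rewrite h.
Qed.

Lemma ler_norm_labs x y : labs x <= y -> `|x| <= `|y|.
Proof.
by move=> xy; apply: ler_norm_labs2; exact: le_trans xy (ler_labs _).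
Qed.

(** The negative part of [x] vanishes: once [0 <= u n], it lies below [labs (x - u n)], whose norm
    is arbitrarily small. *)
Lemma bl_cvg_ge0 u x : (\forall n \near \oo, 0 <= u n) -> u @ \oo --> x -> 0 <= x.
Proof.
move=> u0 ux; suff xm0 : `|Order.join (- x) 0| <= 0.
  move: xm0; rewrite normr_le0 => /eqP xm0.
  by rewrite -bl_lerN oppr0 -xm0 leUl.
apply/ler_addgt0Pl => eps eps0; rewrite addr0.
have [n [un0 unx]] : exists n, 0 <= u n /\ `|x - u n| <= eps.
  have [N _ h] : \forall n \near \oo, 0 <= u n /\ `|x - u n| <= eps.
    near=> n; split; first by near: n.
    by near: n; move/cvgrPdist_le : ux; apply.
  by exists N; apply: h => /=.
apply: le_trans unx; rewrite -[leRHS]norm_labs; apply: ler_norm_labs.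
rewrite labs_ger0 ?leUr// leUx labs_ge0 andbT.
apply: le_trans (lerN_labs _); rewrite opprB -[leLHS]add0r.
by rewrite bl_lerD2r.
Unshelve. all: by end_near. Qed.

Lemma bl_cvg_le {u x y} : (\forall n \near \oo, u n <= y) -> u @ \oo --> x -> x <= y.
Proof.
move=> uy ux; rewrite -bl_subr_ge0; apply: (@bl_cvg_ge0 (fun n => y - u n)).
  by apply: filterS uy => n; rewrite bl_subr_ge0.
by apply: cvgB => //; exact: cvg_cst.
Qed.

Lemma bl_cvg_labs_le {u x z} :
  (\forall n \near \oo, labs (u n) <= z) -> u @ \oo --> x -> labs x <= z.
Proof.
move=> uz ux; rewrite labs_le; apply/andP; split.
  by apply: bl_cvg_le ux; apply: filterS uz => n; rewrite labs_le => /andP[].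
apply: bl_cvg_le (cvgN ux).
by apply: filterS uz => n; rewrite labs_le => /andP[].
Qed.

End BanachLatticeTheory.

(** * Geometric estimates for series in a Banach space *)

Section GeometricSeries.
Context {R : realType}.

Lemma geometric_majorant_cvg (V : completeNormedModType R) (f : V^nat) (c q : R) :
  `|q| < 1 -> (forall n, `|f n| <= c * q ^+ n) ->
  cvgn (series f) /\ `|limn (series f)| <= c / (1 - q).
Proof.
move=> q1 fq; have g := @cvg_geometric_series _ c _ q1.
have cf : cvgn [normed series f].
  apply: (@series_le_cvg _ _ (geometric c q)) => // [n|n|].
  - exact: normr_ge0.
  - exact: le_trans (fq n).
  - exact: cvgP g.
split; first exact: normed_cvg.
apply: le_trans (lim_series_norm cf) _; rewrite -(cvg_lim _ g)//.
by apply: lim_series_le => //; apply: cvgP g.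
Qed.

Lemma half_lt1 : `|2^-1 : R| < 1.
Proof. by rewrite ger0_norm ?invr_ge0// invf_lt1// ltr1n. Qed.

Lemma quarter_lt1 : `|4^-1 : R| < 1.
Proof. by rewrite ger0_norm ?invr_ge0// invf_lt1// ltr1n. Qed.

Lemma small_pow2 (d : R) : 0 < d -> exists N, 2^-1 ^+ N <= d.
Proof.
move=> d0; have /cvgrPdist_le/(_ _ d0)[N _ h] := cvg_expr half_lt1.
exists N; have := h N (leqnn N); rewrite sub0r normrN ger0_norm//.
by rewrite exprn_ge0// invr_ge0.
Qed.

End GeometricSeries.

(** * Order bounds for tails of series *)

Section SeriesInBanachLattice.
Context {R : realType} {X : banachLatticeType R}.

Lemma bl_sum_widen (z : X^nat) (N n : nat) : (forall j, 0 <= z j) ->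
  \sum_(N <= j < n) z j <= \sum_(0 <= j < n) z j.
Proof.
move=> z0; case: (leqP N n) => [Nn|/ltnW nN].
  rewrite [leRHS](@big_cat_nat _ _ _ N)//= -[leLHS]add0r bl_lerD2r.
  by rewrite bl_sumr_ge0.
by rewrite big_geq// bl_sumr_ge0.
Qed.

(** Take [w] to be the sum of the [2^j z_j]. It converges because these terms have norm at most
    [c 2^-j], whose sum is [2 c]; and for [j >= N] the factor [2^-N 2^j] is at least 1, so each
    [z_j] in the tail is below the corresponding term of [2^-N w]. *)
Lemma geometric_regulator (z : X^nat) (c : R) :
  (forall j, 0 <= z j) -> (forall j, `|z j| <= c * 4^-1 ^+ j) ->
  exists w : X, [/\ 0 <= w, `|w| <= 2 * c &
    forall N n, \sum_(N <= j < n) z j <= 2^-1 ^+ N *: w].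
Proof.
move=> z0 zc; pose f j := 2 ^+ j *: z j.
have f0 j : 0 <= f j by rewrite bl_scaler_ge0// exprn_ge0.
have [cf lf] : cvgn (series f) /\ `|limn (series f)| <= c / (1 - 2^-1).
  apply: geometric_majorant_cvg half_lt1 _ => j.
  rewrite normrZ ger0_norm ?exprn_ge0//.
  apply: le_trans (ler_wpM2l _ (zc j)) _; first by rewrite exprn_ge0.
  suff <- : 2 * 4^-1 = 2^-1 :> R by rewrite mulrCA -exprMn.
  by rewrite (_ : 4 = 2 * 2 :> R) ?invfM ?mulVKf ?pnatr_eq0// -natrM.
have sumf n : \sum_(0 <= j < n) f j <= limn (series f).
  rewrite -bl_subr_ge0.
  apply: (@bl_cvg_ge0 _ _ (fun m => series f m - series f n)).
    exists n => // m /= nm; rewrite sub_series nm.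
    exact: bl_sumr_ge0.
  by apply: cvgB => //; exact: cvg_cst.
exists (limn (series f)); split.
- by have := sumf 0%N; rewrite big_geq.
- apply: le_trans lf _; rewrite [leLHS]mulrC ler_wpM2r//.
    by have := zc 0%N; rewrite expr0 mulr1; exact: le_trans.
  by rewrite {1}(splitr 1) mul1r addrK invrK.
move=> N n.
apply: (@le_trans _ _ (2^-1 ^+ N *: \sum_(N <= j < n) f j)); last first.
  apply: bl_ler_wpZ2l; first by rewrite exprn_ge0// invr_ge0.
  exact: le_trans (bl_sum_widen _ _ _ f0) (sumf n).
rewrite scaler_sumr big_seq [leRHS]big_seq; apply: bl_ler_sum => j.
rewrite mem_index_iota => /andP[Nj _].
rewrite /f scalerA -[leLHS]scale1r bl_ler_wpZ2r//.
rewrite -(subnK Nj) exprD mulrCA -exprMn mulVf ?pnatr_eq0// expr1n mulr1.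
by rewrite exprn_ege1// ler1n.
Qed.

(** The bound holds for each finite block from [N] on by the triangle inequality, and order bounds
    pass to norm limits. *)
Lemma labs_series_tail (v z : X^nat) (l w : X) (N : nat) :
  (forall j, labs (v j) <= z j) -> (forall n, \sum_(N <= j < n) z j <= w) ->
  series v @ \oo --> l -> labs (l - series v N) <= w.
Proof.
move=> vz zw vl; apply: (@bl_cvg_labs_le _ _ (fun n => series v n - series v N)).
  exists N => // n /= Nn; rewrite sub_series Nn.
  apply: le_trans (zw n); apply: le_trans (ler_labs_sum _ _ _ _) _.
  exact: bl_ler_sum.
by apply: cvgB => //; exact: cvg_cst.
Qed.

End SeriesInBanachLattice.

(* [mode_cvg u x z] reads "u converges to x, with regulator z"; norm
   convergence ignores z. The field [mode_approx] is closedness under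
   approximations that are small relative to z, uniformly along the sequence. *)
Record convergence_mode (R : realType) (X : banachLatticeType R) := ConvergenceMode {
  mode_cvg :> X^nat -> X -> X -> Prop ;
  mode_near : forall u x z, 0 <= z -> (\forall n \near \oo, u n = x) -> mode_cvg u x z ;
  mode_le : forall u x z z', z <= z' -> mode_cvg u x z -> mode_cvg u x z' ;
  modeD : forall u v x y z,
    mode_cvg u x z -> mode_cvg v y z -> mode_cvg (u + v) (x + y) z ;
  modeZ : forall (c : R) u x z, mode_cvg u x z -> mode_cvg (c *: u) (c *: x) (`|c| *: z) ;
  mode_approx : forall u x z, 0 <= z ->
    (forall d : R, 0 < d -> exists v y, [/\ mode_cvg v y z,
       forall k, labs (u k - v k) <= d *: z & labs (x - y) <= d *: z]) ->
    mode_cvg u x z ;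
  mode_norm_cvg : forall u x z, mode_cvg u x z -> u @ \oo --> x
}.

Arguments convergence_mode {R} X.
Arguments mode_near {R X} _ {u x z}.
Arguments mode_le {R X} _ {u x z z'}.
Arguments modeD {R X} _ {u v x y z}.
Arguments modeZ {R X} _ c {u x z}.
Arguments mode_approx {R X} _ {u x z}.
Arguments mode_norm_cvg {R X} _ {u x z}.

(** * Norm and uniform convergence as two instances of a convergence mode *)

Section Modes.
Context {R : realType} {X : banachLatticeType R}.
Implicit Types (x z : X) (u v : X^nat).

Definition norm_cvg_with u x z : Prop := u @ \oo --> x.

Definition uniform_cvg_with u x z : Prop :=
  forall d : R, 0 < d -> \forall n \near \oo, labs (u n - x) <= d *: z.

Lemma uniform_cvg_with_norm u x z : uniform_cvg_with u x z -> u @ \oo --> x.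
Proof.
move=> h; apply/cvgrPdist_le => d d0.
(* The added 1 keeps the denominator positive when [z = 0]. *)
have d0' : 0 < d / (`|z| + 1) by rewrite divr_gt0// ltr_wpDl.
apply: filterS (h _ d0') => n /ler_norm_labs; rewrite distrC => /le_trans; apply.
rewrite normrZ gtr0_norm// mulrAC ler_pdivrMr ?ltr_wpDl//.
by rewrite ler_wpM2l ?ltW// ltrDl.
Qed.

(** By the Archimedean property, the tolerances [1/m] and arbitrary positive reals [d] are
    interchangeable. *)
Lemma uniform_cvgP u x :
  uniform_cvg u x <-> exists2 z, 0 <= z & uniform_cvg_with u x z.
Proof.
split=> -[z z0 h]; exists z => //.
  move=> d d0; have di0 : 0 < d^-1 by rewrite invr_gt0.
  have dN := archi_boundP (ltW di0); have N0 := lt_trans di0 dN.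
  rewrite ltr0n in N0; apply: filterS (h _ N0) => n /le_trans; apply.
  by apply: bl_ler_wpZ2r => //; rewrite invf_ple ?posrE ?ltr0n// ltW.
by move=> m m0; apply: h; rewrite invr_gt0 ltr0n.
Qed.

(** For [mode_approx], the error [u k - x] splits into [u k - v k], [v k - y] and [y - x], each
    allotted a third of [d]. *)
Let thirds (d : R) : d / 3 + d / 3 + d / 3 = d.
Proof. by rewrite -mulr2n -mulrSr -(mulr_natr (d / 3)) divfK ?pnatr_eq0. Qed.

Program Definition norm_mode : convergence_mode X :=
  @ConvergenceMode R X norm_cvg_with _ _ _ _ _ _.
Next Obligation.
move=> u x z _ ux; rewrite /norm_cvg_with; exact: cvg_near_cst.
Qed.
Next Obligation. by []. Qed.
Next Obligation. by move=> u v x y z; exact: cvgD. Qed.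
Next Obligation. by move=> c u x z ux; apply: cvgZl_tmp. Qed.
Next Obligation.
move=> u x z z0 h; apply/cvgrPdist_le => d d0.
have d0' : 0 < d / 3 / (`|z| + 1) by rewrite !divr_gt0// ltr_wpDl.
have [v [y [vy uv xy]]] := h _ d0'.
have bnd t : labs t <= (d / 3 / (`|z| + 1)) *: z -> `|t| <= d / 3.
  move/ler_norm_labs => /le_trans; apply.
  rewrite normrZ gtr0_norm// mulrAC ler_pdivrMr ?ltr_wpDl//.
  by rewrite ler_wpM2l ?ltW ?divr_gt0// ltrDl.
have /cvgrPdist_le/(_ (d / 3)) := vy.
move=> /(_ (divr_gt0 d0 (ltr0n _ 3))); apply: filterS => k vk.
have -> : x - u k = (x - y) + (y - v k) - (u k - v k).
  by rewrite addrA subrK opprB addrA subrK.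
apply: le_trans (ler_normB _ _) _; apply: le_trans (lerD (ler_normD _ _) (lexx _)) _.
apply: le_trans (lerD (lerD (bnd _ xy) vk) (bnd _ (uv k))) _.
by rewrite thirds.
Qed.
Next Obligation. by []. Qed.

Program Definition uniform_mode : convergence_mode X :=
  @ConvergenceMode R X uniform_cvg_with _ _ _ _ _ _.
Next Obligation.
move=> u x z z0 ux d d0; apply: filterS ux => n ->.
by rewrite subrr labs0 bl_scaler_ge0// ltW.
Qed.
Next Obligation.
move=> u x z z' zz' h d d0; apply: filterS (h _ d0) => n /le_trans; apply.
by apply: bl_ler_wpZ2l => //; exact: ltW.
Qed.
Next Obligation.
move=> u v x y z ux vy d d0; have d2 : 0 < d / 2 by rewrite divr_gt0.
apply: filterS2 (ux _ d2) (vy _ d2) => n h1 h2.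
rewrite opprD addrACA [d in leRHS]splitr scalerDl.
by apply: le_trans (ler_labsD _ _) _; exact: bl_lerD.
Qed.
Next Obligation.
move=> c u x z ux d d0; apply: filterS (ux _ d0) => n h.
rewrite -scalerBr scalerA mulrC -scalerA; apply: le_trans (labsZ _ _) _.
exact: bl_ler_wpZ2l.
Qed.
Next Obligation.
move=> u x z z0 h d d0.
have d0' : 0 < d / 3 by rewrite divr_gt0.
have [v [y [vy uv xy]]] := h _ d0'.
apply: filterS (vy _ d0') => k vk.
have -> : u k - x = (u k - v k) + (v k - y) - (x - y).
  by rewrite addrA subrK opprB addrA subrK.
apply: le_trans (ler_labsD _ _) _; rewrite labsN.
apply: le_trans (bl_lerD _ _ _ _ (ler_labsD _ _) (lexx _)) _.
apply: le_trans (bl_lerD _ _ _ _ (bl_lerD _ _ _ _ (uv k) vk) xy) _.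
by rewrite -[d in leRHS]thirds 2!scalerDl.
Qed.
Next Obligation. exact: uniform_cvg_with_norm. Qed.

End Modes.

(** * Partial sums, expandable vectors and the successive approximation argument *)

Section PartialSums.
Context {R : realType} {X : banachLatticeType R} (e : X^nat).
Implicit Types (a b : R^nat).

Lemma psumsD a b : psums e (a + b) = psums e a + psums e b.
Proof.
apply/funext => k; rewrite /psums /series /=.
under eq_bigr do rewrite [(a + b) _]/= scalerDl.
exact: big_split.
Qed.

Lemma psumsZ (t : R) a : psums e (t *: a) = t *: psums e a.
Proof.
apply/funext => k; rewrite /psums /series /=.
under eq_bigr do rewrite [(t *: a) _]/= -scalerA.
exact/esym/scaler_sumr.
Qed.

Lemma psumsN a : psums e (- a) = - psums e a.
Proof. by rewrite -scaleN1r psumsZ scaleN1r. Qed.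

Lemma psums0 : psums e 0 = 0.
Proof. by rewrite -(scale0r (0 : R^nat)) psumsZ scale0r. Qed.

Lemma psumsS a k : psums e a k.+1 = psums e a k + a k *: e k.
Proof. by rewrite /psums /series /= big_nat_recr. Qed.

Lemma psums_sum (a : nat -> R^nat) N k :
  psums e (\sum_(0 <= j < N) a j) k = series (fun j => psums e (a j) k) N.
Proof.
elim: N => [|N IH]; first by rewrite !big_geq// psums0 /series /= big_geq.
by rewrite big_nat_recr//= psumsD /= seriesSr -IH.
Qed.

Lemma psums_inj0 a : (forall n, e n != 0) -> (forall k, psums e a k = 0) -> a = 0.
Proof.
move=> e0 a0; apply/funext => n; apply/eqP.
have := psumsS a n; rewrite !a0 add0r => /esym/eqP.
by rewrite scaler_eq0 (negbTE (e0 n)) orbF.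
Qed.

(** One vector [z] serves both as regulator of the convergence and as bound on all partial sums, so
    a single norm estimate controls both. *)
Definition expands (m : convergence_mode X) (c : R) (x : X) : Prop :=
  exists a z, [/\ m (psums e a) x z, forall k, labs (psums e a k) <= z & `|z| <= c].

Section Expands.
Variable m : convergence_mode X.

Lemma expandsZ (t c : R) x : expands m c x -> expands m (`|t| * c) (t *: x).
Proof.
move=> [a [z [mx az zc]]]; exists (t *: a), (`|t| *: z).
rewrite psumsZ; split; first exact: modeZ.
- move=> k; apply: le_trans (labsZ _ _) _; exact: bl_ler_wpZ2l.
- by rewrite normrZ normr_id ler_wpM2l.
Qed.

Lemma expandsB (c d : R) x y :
  expands m c x -> expands m d y -> expands m (c + d) (x - y).
Proof.
move=> [a [z [mx az zc]]] [b [w [my bw wd]]].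
have z0 := labs_le_ge0 (az 0%N); have w0 := labs_le_ge0 (bw 0%N).
exists (a - b), (z + w); rewrite psumsD psumsN; split.
- apply: modeD.
    by apply: mode_le mx; rewrite -[leLHS]addr0 bl_lerD2l.
  rewrite -scaleN1r -(scaleN1r y); apply: mode_le (modeZ _ _ my).
  by rewrite normrN1 scale1r -[leLHS]add0r bl_lerD2r.
- move=> k; apply: le_trans (ler_labsD _ _) _; rewrite labsN.
  exact: bl_lerD.
- exact: le_trans (ler_normD _ _) (lerD zc wd).
Qed.

(** The expansions are added coefficientwise. With the regulator [z] of [geometric_regulator], both
    the partial sums and the limit differ from those of the first [N] expansions by at most
    [2^-N z], uniformly in [k], so [mode_approx] applies. *)
Lemma expands_series (c : R) (a : nat -> R^nat) (x_ z_ : X^nat) (x : X) :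
  (forall n, e n != 0) ->
  (forall j, m (psums e (a j)) (x_ j) (z_ j)) ->
  (forall j k, labs (psums e (a j) k) <= z_ j) ->
  (forall j, `|z_ j| <= c * 4^-1 ^+ j) ->
  series x_ @ \oo --> x -> expands m (2 * c) x.
Proof.
move=> e0 ax az zc x_x.
have z0 j : 0 <= z_ j := labs_le_ge0 (az j 0%N).
have xz j : labs (x_ j) <= z_ j.
  by apply: bl_cvg_labs_le (mode_norm_cvg _ (ax j)); apply: nearW.
have [z [zge0 zc2 ztail]] := geometric_regulator _ _ z0 zc.
(* The vector [a j n *: e n] is a difference of two partial sums dominated by [z_ j]; hence the
   bound [2 c 4^-j / |e n|] on the coefficient. *)
have coef_cvg n : cvgn (series (a^~ n)).
  apply: (geometric_majorant_cvg R (a^~ n) (2 * c / `|e n|) _ quarter_lt1 _).1 => j.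
  rewrite mulrAC ler_pdivlMr ?normr_gt0// -normrZ.
  have -> : a j n *: e n = psums e (a j) n.+1 - psums e (a j) n.
    by rewrite psumsS addrC addKr.
  apply: le_trans (ler_normB _ _) _; rewrite -mulrA mulr_natl mulr2n.
  by apply: lerD; apply: le_trans (ler_norm_labs _ _ (az _ _)) (zc _).
pose b n := limn (series (a^~ n)).
pose aN N : R^nat := \sum_(0 <= j < N) a j.
have bcvg k : series (fun j => psums e (a j) k) @ \oo --> psums e b k.
  rewrite (_ : series _ = fun N => psums e (aN N) k); last first.
    by apply/funext => N; rewrite psums_sum.
  elim: k => [|k IH].
    rewrite /psums /series /=; under eq_fun do rewrite big_geq//.
    by rewrite big_geq//; exact: cvg_cst.
  under eq_fun do rewrite psumsS; rewrite psumsS; apply: cvgD => //.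
  apply: cvgZr_tmp; have := coef_cvg k; rewrite /b.
  rewrite (_ : series _ = fun N => aN N k)//.
  by apply/funext => N; rewrite /aN fct_sumE.
have approx_b N k : labs (psums e b k - psums e (aN N) k) <= 2^-1 ^+ N *: z.
  rewrite psums_sum; exact: labs_series_tail (bcvg k).
have approx_x N : labs (x - series x_ N) <= 2^-1 ^+ N *: z.
  exact: labs_series_tail x_x.
(* Each [z_ j] is below [z], so [z] is a common regulator for the first [N] expansions. *)
have aN_x N : m (psums e (aN N)) (series x_ N) z.
  elim: N => [|N IH].
    rewrite /aN big_geq// psums0 /series /= big_geq//; apply: mode_near => //.
    exact: nearW.
  rewrite /aN big_nat_recr//= psumsD seriesSr; apply: modeD => //.
  apply: mode_le (ax N); apply: le_trans (_ : \sum_(0 <= j < N.+1) z_ j <= _).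
    by rewrite big_nat_recr//= -[leLHS]add0r bl_lerD2r bl_sumr_ge0.
  by have := ztail 0%N N.+1; rewrite expr0 scale1r.
exists b, z; split => //.
  apply: mode_approx => // d d0; have [N Nd] := small_pow2 _ d0.
  exists (psums e (aN N)), (series x_ N); split => // [k|].
    by apply: le_trans (approx_b N k) _; exact: bl_ler_wpZ2r.
  by apply: le_trans (approx_x N) _; exact: bl_ler_wpZ2r.
(* At [N = 0] the subtracted sum is empty, and the tail estimate is the bound by [z] itself. *)
move=> k; have := approx_b 0%N k.
by rewrite /aN big_geq// psums0 subr0 expr0 scale1r.
Qed.

(** Successive approximation: a remainder of norm below [r 4^-j] is scaled up into the ball,
    approximated within [r / 4] and scaled back. This leaves a remainder below [r 4^-(j+1)] and
    gives a summand with bound [c 4^-j], as [expands_series] requires. *)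
Lemma expands_ball (c r : R) : (forall n, e n != 0) -> 0 < r ->
  (forall y eps, `|y| < r -> 0 < eps -> exists2 w, expands m c w & `|y - w| < eps) ->
  forall x, `|x| < r -> expands m (2 * c) x.
Proof.
move=> e0 r0 dense_c x xr.
(* The pair holds the stage and the current remainder. The implication makes the statement total, so
   that [choice] applies; for a remainder that is too large, 0 is a dummy value. *)
have step (p : nat * X) : exists w, `|p.2| < r * 4^-1 ^+ p.1 ->
    expands m (c * 4^-1 ^+ p.1) w /\ `|p.2 - w| < r * 4^-1 ^+ p.1.+1.
  case: p => j y /=; have [yr|yr] := ltP `|y| (r * 4^-1 ^+ j); last by exists 0.
  have q0 : 0 < 4^-1 ^+ j :> R by rewrite exprn_gt0// invr_gt0.
  have [||w wc wy] := dense_c ((4^-1 ^+ j)^-1 *: y) (r / 4).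
  - by rewrite normrZ normfV gtr0_norm// mulrC ltr_pdivrMr.
  - by rewrite divr_gt0.
  exists (4^-1 ^+ j *: w) => _; split.
    by rewrite -[X in c * X]gtr0_norm// mulrC; exact: expandsZ.
  have -> : y - 4^-1 ^+ j *: w = 4^-1 ^+ j *: ((4^-1 ^+ j)^-1 *: y - w).
    by rewrite scalerBr scalerA divff ?gt_eqF// scale1r.
  by rewrite normrZ gtr0_norm// exprS mulrA [ltRHS]mulrC ltr_pM2l.
have [w wP] := choice step.
pose y := fix y j := if j is j'.+1 then y j' - w (j', y j') else x.
have yr j : `|y j| < r * 4^-1 ^+ j.
  elim: j => [|j IH]; first by rewrite expr0 mulr1.
  exact: (wP (j, y j) IH).2.
pose x_ j := w (j, y j).
have /choice[p pP] j : exists p : R^nat * X, [/\ m (psums e p.1) (x_ j) p.2,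
    forall k, labs (psums e p.1 k) <= p.2 & `|p.2| <= c * 4^-1 ^+ j].
  by have [a [z h]] := (wP (j, y j) (yr j)).1; exists (a, z).
apply: (expands_series c (fun j => (p j).1) x_ (fun j => (p j).2)) => //.
- by move=> j; have [] := pP j.
- by move=> j; have [] := pP j.
- by move=> j; have [] := pP j.
(* The sum telescopes, since [x_ j] is the difference of the remainders [y j] and [y j.+1]. *)
have -> : series x_ = fun N => x - y N.
  apply/funext; elim=> [|N IH]; first by rewrite /series /= big_geq// subrr.
  by rewrite seriesSr IH /= opprB [w _ - _]addrC addrA.
apply/cvgrPdist_le => d d0.
have := @cvg_geometric _ r _ quarter_lt1 => /cvgrPdist_le/(_ _ d0).
apply: filterS => N; rewrite sub0r normrN opprB addrC subrK => h.
apply: le_trans (ltW (yr N)) _; apply: le_trans h; exact: ler_norm.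
Qed.

End Expands.

End PartialSums.

(** If all the open complements of the closures were dense, Baire's theorem would give a point
    outside every [A n]. So some closure has interior points. *)
Lemma Baire_cover (R : realType) (U : completeNormedModType R) (A : (set U)^nat) :
  \bigcup_n A n = setT ->
  exists n x, exists2 r : R, 0 < r & forall y, `|x - y| < r -> closure (A n) y.
Proof.
move=> AT; have [n nd] : exists n, ~ dense (~` closure (A n)).
  apply/existsNP => all_dense.
  have /Baire/(_ setT) : forall i, open (~` closure (A i)) /\ dense (~` closure (A i)).
    by move=> i; split; [rewrite openC; exact: closed_closure | exact: all_dense].
  case=> [||x [_ xA]]; [by exists 0 | exact: openT |].
  have [n _ xn] : (\bigcup_n A n) x by rewrite AT.
  by apply: (xA n I); exact: subset_closure.
move/denseNE : nd => [O [[x [oO Ox]] Oc]].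
have /nbhs_ballP[r r0 rO] : nbhs x O by exact: open_nbhs_nbhs.
exists n, x, r => // y xy; apply: contrapT => ny.
suff : (O `&` ~` closure (A n)) y by rewrite Oc.
by split=> //; apply: rO; rewrite -ball_normE.
Qed.

(** * The maximal inequality: derivation from a basis, consequences, and its form with finite
    joins *)

Section MaximalInequality.
Context {R : realType} {X : banachLatticeType R} (e : X^nat).
Hypothesis e_neq0 : forall n, e n != 0.

(** Makes a finite sum into an expansion with eventually constant partial sums, which converges in
    every mode. *)
Definition truncate (m : nat) (a : R^nat) : R^nat :=
  fun i => if (i < m)%N then a i else 0.

Lemma psums_truncate a m k : psums e (truncate m a) k = psums e a (minn k m).
Proof.
elim: k => [|k IH]; first by rewrite min0n /psums /series /= !big_geq.
rewrite psumsS IH /truncate; case: ltnP => km.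
  by rewrite (minn_idPl km) psumsS.
by rewrite scale0r addr0 (minn_idPr (leqW km)).
Qed.

Lemma mode_truncate (cv : convergence_mode X) a m (z : X) : 0 <= z ->
  cv (psums e (truncate m a)) (psums e a m) z.
Proof.
move=> z0; apply: mode_near => //.
by exists m => // k /= mk; rewrite psums_truncate (minn_idPr mk).
Qed.

(** Condition (3) with an arbitrary dominating vector [w] in place of the finite join; [m] counts
    the terms, so the empty sum is included. *)
Definition maximal_inequality (M : R) : Prop := forall (a : R^nat) (m : nat),
  exists2 w : X, forall k, (k <= m)%N -> labs (psums e a k) <= w
    & `|w| <= M * `|psums e a m|.

(** The sets of vectors expandable with bound [n] cover [X], so Baire's theorem and [expands_ball]
    give one bound for a whole ball. A finite sum scaled into that ball has, by uniqueness, only its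
    own truncated expansion, which therefore obeys the bound. *)
Lemma basis_maximal_inequality (cv : convergence_mode X) :
  (forall x, exists c, expands e cv c x) ->
  (forall a b x z, cv (psums e a) x z -> cv (psums e b) x z -> a = b) ->
  exists2 M, 0 <= M & maximal_inequality M.
Proof.
move=> basis uniq.
have cover : \bigcup_n [set x | expands e cv n%:R x] = setT.
  apply/seteqP; split=> // x _; have [c [a [z [ax az zc]]]] := basis x.
  exists (Num.truncn c).+1 => //; exists a, z; split=> //.
  by apply: le_trans zc _; apply/ltW; exact: truncnS_gt.
have [n [x0 [r r0 x0r]]] := Baire_cover _ _ _ cover.
have near_ball y eps : `|x0 - y| < r -> 0 < eps ->
    exists2 w, expands e cv n%:R w & `|y - w| < eps.
  move=> /x0r cy eps0; have [w [wn yw]] := cy _ (nbhsx_ballx y eps eps0).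
  by exists w => //; move: yw; rewrite -ball_normE.
have ball_expands := expands_ball e cv (n%:R + n%:R) r e_neq0 r0.
have {}ball_expands x : `|x| < r -> expands e cv (2 * (n%:R + n%:R)) x.
  (* Recentring at 0: the difference of approximants of [x0 + y] and of [x0] approximates [y], and
     the bounds add up to [n + n]. *)
  apply: ball_expands => {x} y eps yr eps0.
  have eps2 : 0 < eps / 2 by rewrite divr_gt0.
  have [|v vn vy] := near_ball (x0 + y) _ _ eps2.
    by rewrite opprD addrA subrr sub0r normrN.
  have [|u un ux] := near_ball x0 _ _ eps2; first by rewrite subrr normr0.
  exists (v - u); first exact: expandsB.
  have -> : y - (v - u) = (x0 + y - v) - (x0 - u).
    by rewrite !opprB -(addrA x0 y) [u - x0]addrC addrACA subrr add0r addrA addrAC.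
  rewrite [eps]splitr; apply: le_lt_trans (ler_normB _ _) _; exact: ltrD.
pose C : R := 2 * (n%:R + n%:R).
have C0 : 0 <= C by rewrite mulr_ge0// addr_ge0.
exists (2 / r * C); first by rewrite mulr_ge0// divr_ge0// ltW.
move=> a m; set x := psums e a m.
(* A zero sum cannot be scaled to a given norm; here uniqueness makes the truncated coefficients
   vanish. *)
have [x_0|x_neq0] := eqVneq x 0.
  exists 0; last by rewrite normr0 x_0 normr0 mulr0.
  move=> k km.
  have a0 : truncate m a = 0.
    apply: (uniq _ _ 0 0); first by rewrite -[X in cv _ X _]x_0; exact: mode_truncate.
    by rewrite psums0; apply: mode_near => //; exact: nearW.
  by rewrite -(minn_idPl km) -psums_truncate a0 psums0 labs0.
have x_gt0 : 0 < `|x| by rewrite normr_gt0.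
(* This gives [t *: x] the norm [r / 2], strictly inside the ball; [t^-1] accounts for the factor
   [2 / r] in the constant. *)
pose t := r / 2 / `|x|; have t0 : 0 < t by rewrite !divr_gt0.
have [b [z [bx bz zC]]] : expands e cv C (t *: x).
  apply: ball_expands; rewrite normrZ gtr0_norm// /t divfK ?gt_eqF//.
  by rewrite ltr_pdivrMr// ltr_pMr// ltr1n.
have z0 := labs_le_ge0 (bz 0%N).
have ba : b = t *: truncate m a.
  apply: uniq bx _; rewrite psumsZ.
  have := modeZ cv t (mode_truncate cv a m (t^-1 *: z) _).
  rewrite gtr0_norm// scalerA divff ?gt_eqF// scale1r; apply.
  by apply: bl_scaler_ge0 => //; rewrite invr_ge0 ltW.
exists (t^-1 *: z).
  move=> k km; have := bz k; rewrite ba psumsZ => h.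
  have -> : psums e a k = t^-1 *: (t *: psums e (truncate m a)) k.
    by rewrite scalerA mulVf ?gt_eqF// scale1r psums_truncate (minn_idPl km).
  have ti0 : 0 <= t^-1 by rewrite invr_ge0 ltW.
  apply: le_trans (labsZ _ _) _; rewrite ger0_norm//; exact: bl_ler_wpZ2l.
rewrite normrZ gtr0_norm ?invr_gt0// /t !invf_div -[leLHS]mulrA [leRHS]mulrC.
by rewrite !ler_wpM2l// divr_ge0// ltW.
Qed.

Section FromMaximalInequality.
Variable M : R.
Hypotheses (M_ge0 : 0 <= M) (e_max : maximal_inequality M).

Lemma truncate_expands (cv : convergence_mode X) a m :
  expands e cv (M * `|psums e a m|) (psums e a m).
Proof.
have [w aw wM] := e_max a m; exists (truncate m a), w; split => //.
  by apply: mode_truncate; exact: labs_le_ge0 (aw 0%N _).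
by move=> k; rewrite psums_truncate aw// geq_minr.
Qed.

(** Finite sums are dense and expandable with bound [M] times their norm, so [expands_ball] covers
    the unit ball; scaling by [|x| + 1] reaches every [x]. *)
Lemma maximal_inequality_expands (cv : convergence_mode X) :
  closure (lin_span e) = [set: X] -> forall x, exists c, expands e cv c x.
Proof.
move=> e_span x.
have unit_ball y : `|y| < 1 -> expands e cv (2 * (M * 2)) y.
  apply: (expands_ball e cv _ _ e_neq0 ltr01) => {}y eps y1 eps0.
  have : closure (lin_span e) y by rewrite e_span.
  (* Distance below 1 from [y] in the unit ball keeps the norm of the finite sum at most 2, whence
     the bound [M * 2]. *)
  have eps1 : 0 < Num.min eps 1 by rewrite lt_min eps0 ltr01.
  move=> /(_ _ (nbhsx_ballx y _ eps1)) [_ [[a [m ->]]]].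
  rewrite -ball_normE /= lt_min => /andP[yeps y11].
  exists (psums e a m) => //.
  have [b [z [bx bz zc]]] := truncate_expands cv a m.
  exists b, z; split=> //; apply: le_trans zc _; rewrite ler_wpM2l//.
  rewrite -[psums e a m](subKr y); apply: le_trans (ler_normB _ _) _.
  by rewrite [leRHS](_ : 2 = 1 + 1 :> R)// lerD// ltW.
pose t := `|x| + 1; have t0 : 0 < t by rewrite ltr_wpDl.
exists (`|t| * (2 * (M * 2))).
have -> : x = t *: (t^-1 *: x) by rewrite scalerA divff ?gt_eqF// scale1r.
apply: expandsZ; apply: unit_ball.
by rewrite normrZ normfV gtr0_norm// mulrC ltr_pdivrMr// mul1r ltrDl.
Qed.

(** The partial sums of [a - b] tend to 0, and each is bounded in norm by [M] times any later one.
    So all vanish, and the nonzero [e n] force zero coefficients. *)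
Lemma maximal_inequality_uniq a b (x : X) :
  psums e a @ \oo --> x -> psums e b @ \oo --> x -> a = b.
Proof.
move=> ax bx; apply/eqP; rewrite -subr_eq0; apply/eqP; apply: (psums_inj0 e) => // k.
have ab0 : psums e (a - b) @ \oo --> 0.
  by rewrite psumsD psumsN -(subrr x); exact: cvgB.
apply/eqP; rewrite -normr_le0; apply/ler_addgt0Pl => d d0; rewrite addr0.
have d0' : 0 < d / (M + 1) by rewrite divr_gt0// ltr_wpDl.
move/cvgrPdist_le : ab0 => /(_ _ d0')[N _ hN].
have [w aw wM] := e_max (a - b) (maxn k N).
apply: le_trans (ler_norm_labs _ _ (aw k (leq_maxl _ _))) _.
have := hN _ (leq_maxr k N); rewrite sub0r normrN => {}hN.
apply: le_trans wM _; apply: le_trans (ler_wpM2l M_ge0 hN) _.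
by rewrite mulrCA ler_piMr ?(ltW d0)// ler_pdivrMr ?ltr_wpDl// mul1r lerDl.
Qed.

End FromMaximalInequality.

Lemma ler_bigjoin (I : eqType) (r : seq I) (F : I -> X) (x : X) i :
  i \in r -> F i <= \big[Order.join/x]_(j <- r) F j.
Proof.
elim: r => // j r IH; rewrite inE big_cons => /orP[/eqP ->|/IH Fi].
  exact: leUl.
exact: le_trans Fi (leUr _ _).
Qed.

Lemma bigjoin_ler (I : Type) (r : seq I) (F : I -> X) (x w : X) :
  x <= w -> (forall i, F i <= w) -> \big[Order.join/x]_(j <- r) F j <= w.
Proof. by move=> xw Fw; elim/big_ind: _ => // y z; rewrite leUx => -> ->. Qed.

Lemma maximal_inequalityP :
  (exists M : R, forall (m : nat) (a : m.+1.-tuple R),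
    let s (k : nat) : X := \sum_(n < k.+1) a`_n *: e n in
    `| \big[Order.join/labs (s 0%N)]_(k < m.+1) labs (s k) | <= M * `| s m |) <->
  exists2 M, 0 <= M & maximal_inequality M.
Proof.
split=> [[M h]|[M M0 h]].
  (* The constant in (3) carries no sign, hence the absolute value. The empty sum is treated apart,
     as the tuples have length [m.+1]. *)
  exists `|M| => // a [|m].
    exists 0; last by rewrite normr0 mulr_ge0.
    by move=> k; rewrite leqn0 => /eqP ->; rewrite /psums /series /= big_geq// labs0.
  pose t : m.+1.-tuple R := [tuple a i | i < m.+1].
  have tE k : (k <= m)%N -> \sum_(n < k.+1) t`_n *: e n = psums e a k.+1.
    move=> km; rewrite /psums /series /= big_mkord; apply: eq_bigr => i _.
    have im : (i < m.+1)%N by exact: leq_trans (ltn_ord i) _.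
    by rewrite -(tnth_nth 0 t (Ordinal im)) tnth_mktuple.
  have := h m t; cbv beta zeta; rewrite (tE m)// => {}h.
  set w := \big[_/_]_(_ < _) _ in h; exists w; last first.
    by apply: le_trans h _; rewrite ler_wpM2r// ler_norm.
  have wk k : (k <= m)%N -> labs (psums e a k.+1) <= w.
    move=> km; rewrite -tE//.
    pose F (k : 'I_m.+1) := labs (\sum_(n < k.+1) t`_n *: e n).
    exact: (ler_bigjoin _ _ F _ (Ordinal (km : (k < m.+1)%N)) (mem_index_enum _)).
  case=> [_|k km]; last exact: wk.
  rewrite /psums /series /= big_geq// labs0; exact: labs_le_ge0 (wk 0%N _).
exists M => m a; pose s (k : nat) : X := \sum_(n < k.+1) a`_n *: e n.
rewrite -/(s _); cbv zeta; rewrite -/s.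
have sE k : s k = psums e (fun i => a`_i) k.+1.
  by rewrite /s /psums /series /= big_mkord.
have [w aw wM] := h (fun i => a`_i) m.+1; rewrite -(sE m) in wM.
apply: le_trans wM; apply: ler_norm_labs; rewrite labs_ger0.
  by apply: bigjoin_ler => [|i]; rewrite sE aw.
apply: le_trans (labs_ge0 (s ord0)) _.
exact: (ler_bigjoin _ _ (fun k : 'I_m.+1 => labs (s k)) _ ord0 (mem_index_enum _)).
Qed.

End MaximalInequality.

(** * The bases of (1) and (2) and the maximal inequality *)

Section Bases.
Context {R : realType} {X : banachLatticeType R} (e : X^nat).
Hypothesis e_neq0 : forall n, e n != 0.

Lemma biorth_unique a x : schauder_basis e -> psums e a @ \oo --> x ->
  forall n, biorth e n x = a n.
Proof.
move=> basis ax n; have [b [bx b_uniq]] := basis x.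
rewrite /biorth; case: xgetP => [c _ cx|/(_ a)//].
by rewrite -(b_uniq _ cx) -(b_uniq _ ax).
Qed.

Lemma basis_proj_psums a x m : schauder_basis e -> psums e a @ \oo --> x ->
  basis_proj e m x = psums e a m.
Proof.
move=> basis ax; rewrite /basis_proj /psums /series /= big_mkord.
by apply: eq_bigr => i _; rewrite (biorth_unique a).
Qed.

Lemma uniform_basis_maximal : uniform_basis e ->
  exists2 M, 0 <= M & maximal_inequality e M.
Proof.
move=> basis; apply: (basis_maximal_inequality e e_neq0 uniform_mode) => [x|].
  have [a [/uniform_cvgP[z z0 ax] _]] := basis x.
  have [N _ hN] := ax 1 ltr01.
  (* From [N] on the partial sums are dominated by [z + labs x]; [w] takes care of the finitely many
     earlier ones. *)
  pose w := \sum_(0 <= i < N) labs (psums e a i).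
  have w0 : 0 <= w by apply: bl_sumr_ge0 => i _; exact: labs_ge0.
  exists `|z + labs x + w|, a, (z + labs x + w); split=> //.
    apply: (mode_le uniform_mode _ ax); rewrite -addrA -[leLHS]addr0 bl_lerD2l.
    by rewrite -(addr0 0) bl_lerD// labs_ge0.
  move=> k; have [kN|Nk] := ltnP k N.
    rewrite -[leLHS]add0r; apply: bl_lerD.
      by rewrite -(addr0 0) bl_lerD// labs_ge0.
    rewrite /w (bigD1_seq k) ?mem_index_iota ?iota_uniq//= -[leLHS]addr0 bl_lerD2l.
    by apply: bl_sumr_ge0 => i _; exact: labs_ge0.
  rewrite -[leLHS]addr0; apply: bl_lerD => //.
  rewrite -[psums e a k](subrK x); apply: le_trans (ler_labsD _ _) _.
  by rewrite bl_lerD2r -[z]scale1r; exact: hN.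
move=> a b x z ax bx.
have z0 : 0 <= z.
  have [N _ /(_ N (leqnn N))] := ax 1 ltr01.
  by rewrite scale1r => /labs_le_ge0.
have [c [_ c_uniq]] := basis x.
by transitivity c; [apply/esym|]; apply: c_uniq; apply/uniform_cvgP; exists z.
Qed.

Lemma schauder_basis_maximal : schauder_basis e ->
  (forall x : X, order_bounded [set basis_proj e m x | m in [set m | (1 <= m)%N]]) ->
  exists2 M, 0 <= M & maximal_inequality e M.
Proof.
move=> basis bounded; apply: (basis_maximal_inequality e e_neq0 norm_mode) => [x|].
  have [a [ax _]] := basis x; have [[l lP] [h hP]] := bounded x.
  exists `|labs h + labs l|, a, (labs h + labs l); split=> //.
  (* The empty partial sum is not among the projections with [m >= 1], so it is bounded directly. *)
  case=> [|k].
    rewrite /psums /series /= big_geq// labs0 -(addr0 0).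
    by apply: bl_lerD; exact: labs_ge0.
  have proj_k : [set basis_proj e m x | m in [set m | (1 <= m)%N]] (psums e a k.+1).
    by exists k.+1 => //; exact: basis_proj_psums.
  rewrite labs_le; apply/andP; split.
    rewrite -[leLHS]addr0; apply: bl_lerD (labs_ge0 _).
    exact: le_trans (hP _ proj_k) (ler_labs _).
  rewrite -[leLHS]add0r; apply: bl_lerD; first exact: labs_ge0.
  by apply: le_trans (lerN_labs _); rewrite bl_lerN; exact: lP.
move=> a b x z ax bx; have [c [_ c_uniq]] := basis x.
by transitivity c; [apply/esym|]; exact: c_uniq.
Qed.

Hypothesis e_span : closure (lin_span e) = [set: X].
Variable M : R.
Hypotheses (M_ge0 : 0 <= M) (e_max : maximal_inequality e M).

(** Existence comes from expandability in the uniform mode. Uniqueness is inherited from norm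
    convergence, which both expansions satisfy. *)
Lemma maximal_uniform_basis : uniform_basis e.
Proof.
move=> x; have [c [a [z [ax az _]]]] :=
  maximal_inequality_expands e e_neq0 M M_ge0 e_max uniform_mode e_span x.
exists a; split; first by apply/uniform_cvgP; exists z => //; exact: labs_le_ge0 (az 0%N).
move=> b /uniform_cvgP[w _ bx].
apply: (maximal_inequality_uniq e e_neq0 M M_ge0 e_max _ _ x).
  exact: mode_norm_cvg ax.
exact: uniform_cvg_with_norm bx.
Qed.

Lemma maximal_schauder_basis : schauder_basis e.
Proof.
move=> x; have [c [a [z [ax _ _]]]] :=
  maximal_inequality_expands e e_neq0 M M_ge0 e_max norm_mode e_span x.
exists a; split=> // b bx.
exact: (maximal_inequality_uniq e e_neq0 M M_ge0 e_max _ _ x).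
Qed.

Lemma maximal_order_bounded (x : X) :
  order_bounded [set basis_proj e m x | m in [set m | (1 <= m)%N]].
Proof.
have [c [a [z [ax az _]]]] :=
  maximal_inequality_expands e e_neq0 M M_ge0 e_max norm_mode e_span x.
have projE m : basis_proj e m x = psums e a m.
  exact: basis_proj_psums maximal_schauder_basis ax.
split; [exists (- z) | exists z] => _ [m _ <-]; rewrite projE.
  by rewrite -[leRHS]opprK bl_lerN; exact: le_trans (lerN_labs _) (az m).
exact: le_trans (ler_labs _) (az m).
Qed.

End Bases.

Theorem corollary1p3 (R : realType) (X : banachLatticeType R) (e : nat -> X)
  (e_neq0 : forall n, e n != 0)
  (e_span : closure (lin_span e) = [set: X]) :
  let cond1 := uniform_basis e in
  let cond2 := schauder_basis e /\
    forall x : X, order_bounded [set basis_proj e m x | m in [set m | (1 <= m)%N]] in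
  let cond3 := exists M : R, forall (m : nat) (a : m.+1.-tuple R),
    let s (k : nat) : X := \sum_(n < k.+1) a`_n *: e n in
    `| \big[Order.join/labs (s 0%N)]_(k < m.+1) labs (s k) | <= M * `| s m | in
  (cond1 <-> cond2) /\ (cond2 <-> cond3).
Proof.
move=> cond1 cond2 cond3.
have cond3P : cond3 <-> exists2 M, 0 <= M & maximal_inequality e M.
  exact: maximal_inequalityP.
have h1 : cond1 -> cond3 by move=> /(uniform_basis_maximal e e_neq0)/cond3P.
have h2 : cond2 -> cond3.
  by move=> [b ob]; apply/cond3P; exact: schauder_basis_maximal.
have h31 : cond3 -> cond1 by move=> /cond3P[M]; exact: maximal_uniform_basis.
have h32 : cond3 -> cond2.
  move=> /cond3P[M M0 e_max]; split; first exact: maximal_schauder_basis M0 e_max.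
  exact: maximal_order_bounded M0 e_max.
(* Both equivalences are routed through (3). *)
by split; split=> h; auto.
Qed.
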